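(* Let $\Sigma$ be an alphabet, and for integers $n\ge 1$ and $q$ with $1\le q\le n$ (and $|\Sigma|\ge q$) let $SP^{n,q}=\max\{SP(w)\;:\;w\in\Sigma^n,\ |Alph(w)|=q\}$. Then for every $q$ with $\frac{n}{2}\le q\le n$, $$SP^{n,q}=2^{n-q}(2q-n+2)-2.$$
   Context: Words are finite sequences of letters from $\Sigma$. A word $u$ is a scattered subword of $w$ if $u$ can be obtained from $w$ by deleting some (possibly zero) letters, i.e. $u$ is a (not necessarily contiguous) subsequence of $w$. A palindrome is a word equal to its reversal. $SP(w)$ denotes the number of distinct non-empty palindromes that are scattered subwords of $w$. $Alph(w)$ is the set of letters occurring in $w$. *)

(* Defs.v *)
From mathcomp Require Import all_boot.

Set Implicit Arguments.
Unset Strict Implicit.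
Unset Printing Implicit Defensive.

Section ScatteredPalindromes.

Variable Sigma : finType.

Implicit Types u w : seq Sigma.

Definition palindrome u : bool := rev u == u.

Definition Alph w : {set Sigma} := [set x in w].

(* A scattered subword of w has length at most size w, so bounding the
   length of u by size w loses no candidate. *)
Definition SP w : nat :=
  #|[set u : (size w).-bseq Sigma |
      [&& u != [::] :> seq Sigma, palindrome u & subseq u w]]|.

(* The maximum over an empty range is 0; the range is nonempty exactly when
   some w in Sigma^n has q distinct letters. *)
Definition SPmax (n q : nat) : nat :=
  \max_(w : n.-tuple Sigma | #|Alph w| == q) SP w.

End ScatteredPalindromes.

(* Main.v *)
Require Import Defs.
From mathcomp Require Import all_boot zify.

(** Write [d = n - q] and count the empty palindrome too, so that the claim reads
    [npal w + 1 <= 2 ^ d * (q - d + 2)]. The bound is attained by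
    [s ++ t ++ rev s] with [s ++ t] made of [q] distinct letters and [size s = d],
    because wrapping a new letter around a word doubles [npal + 1].

    The upper bound is by induction on the size, peeling off the first letter [a]
    and the last letter [b]. If [a] or [b] occurs once, removing it loses a single
    palindrome; if [a = b], the palindromes are those of the inside, their
    wrappings by [a], and [a]. Otherwise [w = a x a y] with [a] not in [y], and the
    palindromes that need the first [a] are [a v a] with [v] a subword of [x]. The
    induction hypothesis for [x] suffices unless [n = 2q] and [y = b]; there the
    palindromes are sorted by their outer letter. Subwords may have [d > q], so
    the induction is run for words padded with [k] virtual additional letters,
    each of which occurs once and contributes one palindrome. *)

Set Implicit Arguments.
Unset Strict Implicit.
Unset Printing Implicit Defensive.

(** * Subsequences around the first or last occurrence of a letter *)

Section SubsequenceSplitting.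

Variable T : eqType.
Implicit Types (a b : T) (s u v w x y z : seq T).

Lemma split_first a s : a \in s -> exists y x, s = y ++ a :: x /\ a \notin y.
Proof.
elim: s => //= c s IH; rewrite inE.
have [<- _|neq_ac /= /IH [y [x [-> ay]]]] := eqVneq a c; first by exists [::], s.
by exists (c :: y), x; rewrite inE negb_or neq_ac.
Qed.

Lemma split_last a s : a \in s -> exists x y, s = x ++ a :: y /\ a \notin y.
Proof.
rewrite -mem_rev => /split_first [y [x [def_s ay]]].
exists (rev x), (rev y); rewrite mem_rev; split=> //.
by rewrite -(revK s) def_s rev_cat rev_cons cat_rcons.
Qed.

(** Greedy matching: the leading [a] may always be sent to the first [a] available. *)
Lemma subseq_cons_first a v x y :
  a \notin y -> subseq (a :: v) (y ++ a :: x) = subseq v x.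
Proof.
elim: y => [|c y IH]; first by rewrite /= eqxx.
rewrite inE negb_or => /andP[neq_ac ay].
by rewrite cat_cons -(IH ay) [LHS]/= (negPf neq_ac).
Qed.

Lemma subseq_rcons_last a v x y :
  a \notin y -> subseq (rcons v a) (x ++ a :: y) = subseq v x.
Proof.
move=> ay; rewrite -subseq_rev rev_rcons rev_cat rev_cons cat_rcons.
by rewrite subseq_cons_first ?mem_rev ?subseq_rev.
Qed.

Lemma subseq_cons_neq a b u s :
  a != b -> subseq (a :: u) (b :: s) = subseq (a :: u) s.
Proof. by move=> /negPf /= ->. Qed.

Lemma subseq_rcons_neq a b u s :
  a != b -> subseq (rcons u a) (rcons s b) = subseq (rcons u a) s.
Proof.
move=> ab; rewrite -subseq_rev !rev_rcons subseq_cons_neq //.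
by rewrite -rev_rcons subseq_rev.
Qed.

End SubsequenceSplitting.

(** * Letters, wrapped palindromes and their enumeration *)

Section PalindromicSubwords.

Variable T : finType.
Implicit Types (a b : T) (s u v w x y z : seq T).

Definition nletters w := size (undup w).

Lemma nletters_le w : nletters w <= size w.
Proof. exact: size_undup. Qed.

Lemma nletters_cons a s : nletters (a :: s) = (a \notin s) + nletters s.
Proof. by rewrite /nletters /=; case: (a \in s). Qed.

Lemma eq_nletters s1 s2 : s1 =i s2 -> nletters s1 = nletters s2.
Proof. by move=> /perm_undup /perm_size. Qed.

Lemma nletters_rcons a s : nletters (rcons s a) = (a \notin s) + nletters s.
Proof. by rewrite -nletters_cons; apply: eq_nletters => c; rewrite mem_rcons. Qed.

Lemma nletters_sub s1 s2 : {subset s1 <= s2} -> nletters s1 <= nletters s2.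
Proof.
move=> sub12; apply: uniq_leq_size (undup_uniq _) _ => c.
by rewrite !mem_undup => /sub12.
Qed.

Lemma nletters_cat s1 s2 : nletters (s1 ++ s2) <= nletters s1 + size s2.
Proof.
rewrite /nletters undup_cat size_cat leq_add ?size_undup // size_filter.
exact: count_size.
Qed.

Definition wrap a v := a :: rcons v a.

Lemma wrap_inj a : injective (wrap a).
Proof. by move=> v1 v2 [] /rcons_inj []. Qed.

Lemma palindrome_wrap a v : palindrome (wrap a v) = palindrome v.
Proof.
rewrite /palindrome /wrap rev_cons rev_rcons rcons_cons eqseq_cons eqxx /=.
by rewrite eqseq_rcons eqxx andbT.
Qed.

Variant palindrome_spec : seq T -> Prop :=
  | PalindromeNil : palindrome_spec [::]
  | PalindromeOne a : palindrome_spec [:: a]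
  | PalindromeWrap a v of palindrome v : palindrome_spec (wrap a v).

Lemma palindromeP u : palindrome u -> palindrome_spec u.
Proof.
case: u => [_|a u]; first exact: PalindromeNil.
case/lastP: u => [_|v b]; first exact: PalindromeOne.
move=> pal; have eq_ba : b = a.
  by move/eqP: (pal); rewrite rev_cons rev_rcons rcons_cons => -[].
by rewrite eq_ba in pal *; apply: PalindromeWrap; rewrite -(palindrome_wrap a).
Qed.

Fixpoint subwords w : seq (seq T) :=
  if w is a :: w' then subwords w' ++ map (cons a) (subwords w') else [:: [::]].

Lemma mem_subwords u w : (u \in subwords w) = subseq u w.
Proof.
elim: w u => [|a w IH] [|c u] //=; rewrite mem_cat !IH ?sub0seq //.
case: eqP => [->|neq_ca].
  rewrite mem_map ?IH => [|? ? [] //]; apply: orb_idl => cu_w.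
  exact: subseq_trans (subseq_cons u a) cu_w.
by rewrite orbC; case: mapP => // -[v _ [eq_ca]]; case: neq_ca.
Qed.

Definition palseqs w := undup (filter (@palindrome T) (subwords w)).

Lemma mem_palseqs u w : (u \in palseqs w) = palindrome u && subseq u w.
Proof. by rewrite mem_undup mem_filter mem_subwords. Qed.

(* Unlike [SP], this also counts the empty palindrome. *)
Definition npal w := size (palseqs w).

(** Upper bounds come from covering lists, in which repetitions are harmless. *)
Lemma npal_le w (L : seq (seq T)) :
  (forall u, palindrome u -> subseq u w -> u \in L) -> npal w <= size L.
Proof.
move=> sub; apply: uniq_leq_size (undup_uniq _) _ => u.
by rewrite mem_palseqs => /andP[]; apply: sub.
Qed.

Lemma npal_ge w (L : seq (seq T)) :
  uniq L -> (forall u, u \in L -> palindrome u && subseq u w) ->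
  size L <= npal w.
Proof.
by move=> uL sub; apply: uniq_leq_size => // u /sub; rewrite mem_palseqs.
Qed.

Lemma npal_rev w : npal (rev w) = npal w.
Proof.
apply/perm_size/uniq_perm; rewrite ?undup_uniq // => u.
rewrite !mem_palseqs; case: (boolP (palindrome u)) => //= /eqP pal_u.
by rewrite -{1}pal_u subseq_rev.
Qed.

(** * Recurrences for peeling off end letters *)

Lemma npal_cons_notin a s : a \notin s -> npal (a :: s) <= npal s + 1.
Proof.
move=> as_; have -> : npal s + 1 = size (rcons (palseqs s) [:: a]).
  by rewrite size_rcons addn1.
apply: npal_le => u pal_u; rewrite mem_rcons inE mem_palseqs pal_u.
case/palindromeP: pal_u => [_|c|c v _].
- by rewrite sub0seq.
- have [->|ca] := eqVneq c a; first by rewrite eqxx.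
  by rewrite subseq_cons_neq // => ->; rewrite orbT.
- have [->|ca] := eqVneq c a; last by rewrite subseq_cons_neq // => ->; rewrite orbT.
  rewrite /wrap /= eqxx => /mem_subseq/(_ a).
  by rewrite mem_rcons mem_head (negPf as_) => /(_ isT).
Qed.

Lemma npal_rcons_notin a s : a \notin s -> npal (rcons s a) <= npal s + 1.
Proof.
by move=> as_; rewrite -npal_rev rev_rcons -(npal_rev s) npal_cons_notin // mem_rev.
Qed.

Lemma npal_wrap_le a z : npal (wrap a z) <= 2 * npal z + 1.
Proof.
have -> : 2 * npal z + 1 =
    size ([:: a] :: palseqs z ++ map (wrap a) (palseqs z)).
  by rewrite /= size_cat size_map -/(npal z); lia.
apply: npal_le => u pal_u; rewrite inE mem_cat mem_palseqs pal_u.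
case/palindromeP: pal_u => [_|c|c v pal_v].
- by rewrite sub0seq.
- have [->|ca] := eqVneq c a; first by rewrite eqxx.
  by rewrite subseq_cons_neq // (@subseq_rcons_neq _ _ _ [::]) // => ->; rewrite orbT.
- have [->|ca] := eqVneq c a.
    rewrite (mem_map (@wrap_inj a)) mem_palseqs pal_v /wrap /= eqxx -(cats1 z).
    by rewrite subseq_rcons_last // => ->; rewrite !orbT.
  rewrite /wrap subseq_cons_neq // -rcons_cons subseq_rcons_neq // => ->.
  by rewrite orbT.
Qed.

(** A palindrome that needs the first [a] also ends in [a], which may be matched to the last [a];
    its inside then lies in [x]. *)
Lemma npal_last_split a x y :
  a \notin y -> npal (a :: x ++ a :: y) <= npal (x ++ a :: y) + npal x.
Proof.
move=> ay; have -> : npal (x ++ a :: y) + npal x =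
    size (palseqs (x ++ a :: y) ++ map (wrap a) (palseqs x)).
  by rewrite size_cat size_map.
apply: npal_le => u pal_u; rewrite mem_cat mem_palseqs pal_u.
case/palindromeP: pal_u => [_|c|c v pal_v].
- by rewrite sub0seq.
- by rewrite !sub1seq inE mem_cat inE; case: (c == a); rewrite /= ?orbT // => ->.
- have [->|ca] := eqVneq c a; last by rewrite subseq_cons_neq // => ->.
  rewrite (mem_map (@wrap_inj a)) mem_palseqs pal_v /wrap /= eqxx.
  by rewrite subseq_rcons_last // => ->; rewrite orbT.
Qed.

(** Outer letter [a] leaves an inside in [x]. With outer letter [b], only [[:: b; a; b]] can use the
    second [a]; the others lie in [rcons x b]. *)
Lemma npal_two_ends_notin a b x : a != b -> a \notin x ->
  npal (a :: x ++ [:: a; b]) <= npal (rcons x b) + npal x + 2.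
Proof.
move=> ab ax; have -> : npal (rcons x b) + npal x + 2 =
    size ([:: [:: a]; [:: b; a; b]] ++
          palseqs (rcons x b) ++ map (wrap a) (palseqs x)).
  by rewrite !size_cat size_map /= -/(npal x) -/(npal (rcons x b)); lia.
have a_notin_b : a \notin [:: b] by rewrite inE.
apply: npal_le => u pal_u; rewrite !mem_cat mem_palseqs pal_u !inE.
case/palindromeP: pal_u => [_|c|c v pal_v].
- by rewrite sub0seq orbT.
- rewrite !sub1seq mem_rcons !(inE, mem_cat).
  have [->|ca] := eqVneq c a; first by rewrite eqxx.
  by case: (c == b) => /=; rewrite ?orbT ?orbF // => ->; rewrite ?orbT.
have [->|ca] := eqVneq c a.
  rewrite (mem_map (@wrap_inj a)) mem_palseqs pal_v /wrap /= eqxx.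
  by rewrite subseq_rcons_last // => ->; rewrite !orbT.
have -> : a :: x ++ [:: a; b] = rcons (a :: rcons x a) b.
  by rewrite -cats1 -cats1 /= -catA.
have [->|cb] := eqVneq c b; last first.
  rewrite /wrap -rcons_cons subseq_rcons_neq // rcons_cons.
  rewrite subseq_cons_neq // -rcons_cons subseq_rcons_neq // => sub.
  by rewrite (subseq_trans sub (subseq_rcons _ _)) !orbT.
rewrite /wrap rcons_cons subseq_cons_neq 1?eq_sym // -rcons_cons.
rewrite -[rcons (rcons x a) b]cats1 subseq_rcons_last //.
(* The final [a] can only match the last letter of [v]. A palindrome [v] ending in [a], other than
   [[:: a]], has two letters [a], but [rcons x a] has one. *)
suff: subseq (b :: v) (rcons x a) -> v != [:: a] -> subseq (b :: v) x.
  have [-> //|va sub /sub {}sub] := eqVneq v [:: a]; first by rewrite eqxx orbT.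
  suff -> : subseq (b :: rcons v b) (rcons x b) by rewrite orbT.
  by rewrite -rcons_cons -!cats1 cat_subseq ?sub.
case: (palindromeP pal_v) => [||e v' _].
- by rewrite (@subseq_rcons_neq _ b a [::]) // eq_sym.
- move=> e; rewrite (eqseq_cons _ _ _ [::]) andbT => sub ea; move: sub.
  by rewrite (@subseq_rcons_neq _ e a [:: b]).
- have [->|ea] := eqVneq e a; last first.
    by rewrite /wrap -2!rcons_cons subseq_rcons_neq.
  rewrite /wrap -(cats1 x) -2!rcons_cons subseq_rcons_last // => /mem_subseq/(_ a).
  by rewrite !inE eqxx orbT (negPf ax) => /(_ isT).
Qed.

(** The first two terms cover outer letter [a] and outer letters other than [a] and [b]. With outer
    letter [b], the inside lies after the first [b], in [x ++ [:: a]]; adding [y] back keeps control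
    of the number of letters. *)
Lemma npal_two_ends_in a b y x : a != b -> a \in y ++ b :: x -> b \notin y ->
  npal (a :: (y ++ b :: x) ++ [:: a; b]) <=
  2 * npal (y ++ b :: x) + npal (y ++ x ++ [:: a]).
Proof.
move=> ab; set z := y ++ b :: x => az yb.
have bz : b \in z by rewrite mem_cat mem_head orbT.
have -> : 2 * npal z + npal (y ++ x ++ [:: a]) =
    size (palseqs z ++ map (wrap a) (palseqs z)
          ++ map (wrap b) (palseqs (y ++ x ++ [:: a]))).
  by rewrite !size_cat !size_map -/(npal z) -/(npal (y ++ x ++ [:: a])); lia.
have a_notin_b : a \notin [:: b] by rewrite inE.
apply: npal_le => u pal_u; rewrite !mem_cat mem_palseqs pal_u.
case/palindromeP: pal_u => [_|c|c v pal_v].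
- by rewrite sub0seq.
- rewrite !sub1seq inE mem_cat !inE.
  have [->|ca] := eqVneq c a; first by rewrite az.
  by have [->|cb] := eqVneq c b; rewrite ?bz // !orbF /= => ->.
have [->|ca] := eqVneq c a.
  rewrite (mem_map (@wrap_inj a)) mem_palseqs pal_v /wrap /= eqxx.
  by rewrite subseq_rcons_last // => ->; rewrite !orbT.
have [->|cb] := eqVneq c b.
  rewrite (mem_map (@wrap_inj b)) mem_palseqs pal_v /wrap.
  rewrite subseq_cons_neq 1?eq_sym // /z -catA cat_cons subseq_cons_first //.
  rewrite -[[:: a; b]]/([:: a] ++ [:: b]) catA subseq_rcons_last // => sub.
  by rewrite (subseq_trans sub (suffix_subseq _ _)) !orbT.
have -> : a :: z ++ [:: a; b] = rcons (a :: rcons z a) b.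
  by rewrite -cats1 -cats1 /= -catA.
rewrite /wrap -rcons_cons subseq_rcons_neq // rcons_cons.
by rewrite subseq_cons_neq // -rcons_cons subseq_rcons_neq // => ->.
Qed.

(** * The upper bound *)

Lemma npal_nil : npal [::] = 1.
Proof. by []. Qed.

(* [e] is [q + k - d], where [k] counts the virtual letters. *)
Lemma npal_bound w d k e :
  size w = nletters w + d -> e + d = nletters w + k ->
  npal w + k < 2 ^ d * (e + 2).
Proof.
have [m] := ubnP (size w); elim: m w d k e => // m IH [|a w] d k e.
  rewrite npal_nil /nletters /= => _ def_d def_e.
  by have -> : d = 0; rewrite ?expn0; lia.
have [aw|aw] := boolP (a \in w); last first.
  rewrite nletters_cons aw [size _]/= => lt_m def_d def_e.
  (* The removed letter becomes virtual: [d] and [e] are unchanged, and the larger [k] pays for the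
     lost palindrome. *)
  have IHw : npal w + k.+1 < 2 ^ d * (e + 2) by apply: IH; lia.
  by have := npal_cons_notin aw; lia.
case/lastP: w aw => // z b; rewrite mem_rcons inE => az.
have [eq_ab|ab] := eqVneq a b.
  rewrite -{}eq_ab {b az} nletters_cons mem_rcons mem_head nletters_rcons.
  have sz_z := nletters_le z; have := npal_wrap_le a z; rewrite /wrap.
  rewrite [size _]/= size_rcons.
  case: (a \in z) => /= le_z lt_m def_d def_e.
    (* No letter is lost, so [d] drops by 2 and [e] grows by 2; [e + 4 <= 2 * (e + 2)] closes the
       case. *)
    have def_d2 : d = d.-2.+2 by lia.
    have IHz : npal z + k < 2 ^ d.-2 * (e + 2 + 2) by apply: IH; lia.
    by rewrite {1}def_d2 !expnS; move: (2 ^ _) IHz => p IHz; lia.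
  have def_d1 : d = d.-1.+1 by lia.
  have IHz : npal z + k < 2 ^ d.-1 * (e + 2) by apply: IH; lia.
  by rewrite {1}def_d1 !expnS; move: (2 ^ _) IHz => p IHz; lia.
rewrite (negPf ab) orFb in az.
have [bz|bz] := boolP (b \in z); last first.
  have baz : b \notin a :: z by rewrite inE eq_sym (negPf ab).
  rewrite -rcons_cons nletters_rcons baz size_rcons => lt_m def_d def_e.
  have IHaz : npal (a :: z) + k.+1 < 2 ^ d * (e + 2) by apply: IH; lia.
  by have := npal_rcons_notin baz; lia.
(* The whole part after the last [a] is [rcons y b]. *)
have [x [y [def_z ay]]] : exists x y : seq T, z = x ++ a :: y /\ a \notin y.
  exact: split_last.
have ayb : a \notin rcons y b by rewrite mem_rcons inE negb_or ab.
rewrite [size _]/= nletters_cons mem_rcons inE az orbT nletters_rcons bz.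
rewrite size_rcons !add0n => lt_m def_d def_e.
have sz_z : size z = size x + size y + 1 by rewrite def_z size_cat /=; lia.
have xq : nletters z <= nletters x + (size y).+1.
  by rewrite def_z (leq_trans (nletters_cat _ _)).
have szx := nletters_le x.
have xz : nletters x <= nletters z.
  by apply: nletters_sub => c; rewrite def_z mem_cat => ->.
have lez := npal_last_split x ayb; rewrite -rcons_cons -rcons_cat -def_z in lez.
(* [t] counts the positions of [a :: y] that add no new letter to [x], and [d'] below is the excess
   of [x]. *)
have [t def_t] : exists t, nletters x + (size y).+1 = nletters z + t.
  by exists (nletters x + (size y).+1 - nletters z); lia.
have [d' def_d'] : exists d', size x = nletters x + d'.
  by exists (size x - nletters x); lia.
have def_dt : d = d' + t.+2 by lia.
have IHz : npal (rcons z b) + k < 2 ^ (d' + t.+1) * (e.+1 + 2).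
  by apply: IH; rewrite ?size_rcons ?nletters_rcons ?bz; lia.
(* [j] letters of [w] are missing from [x]; they can be replaced by virtual ones,
   of which [i] are then dropped to sharpen the bound. *)
have [j def_j] : exists j, nletters z = nletters x + j.
  by exists (nletters z - nletters x); lia.
have IHx i : i <= k + j -> i <= e + 2 ->
    npal x + (k + j - i) < 2 ^ d' * (e + t + 2 - i + 2).
  by move=> le_i le_i'; apply: IH; lia.
have exp_t : 2 ^ d = 4 * (2 ^ t * 2 ^ d').
  by rewrite def_dt expnD !expnS; move: (2 ^ _) (2 ^ _); lia.
have exp_t1 : 2 ^ (d' + t.+1) = 2 * (2 ^ t * 2 ^ d').
  by rewrite expnD !expnS; move: (2 ^ _) (2 ^ _); lia.
rewrite exp_t1 in IHz.
(* By [IHz], it suffices that [npal x <= 2 ^ t * 2 ^ d' * (2 * e + 2)]. Dropping [i = 2 - t] virtual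
   letters if [e = 0], or [i = 1 - t] otherwise (truncated subtraction), achieves this. Since
   [j = size y + 1 - t], that many are available outside the bad case. *)
have [good|bad] := boolP [|| 0 < e, 0 < k | 0 < size y].
  rewrite exp_t {exp_t exp_t1}.
  case: t => [|[|t]] in def_t def_dt IHz IHx *; rewrite ?expn0 ?expn1 in IHz IHx *.
  - case: e => [|e] in def_e good IHz IHx *.
      have {}IHx := IHx 2 ltac:(lia) ltac:(lia).
      by move: (2 ^ _) IHz IHx => p IHz IHx; lia.
    have {}IHx := IHx 1 ltac:(lia) ltac:(lia).
    by move: (2 ^ _) IHz IHx => p IHz IHx; lia.
  - case: e => [|e] in def_e good IHz IHx *.
      have {}IHx := IHx 1 ltac:(lia) ltac:(lia).
      by move: (2 ^ _) IHz IHx => p IHz IHx; lia.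
    have {}IHx := IHx 0 ltac:(lia) ltac:(lia).
    by move: (2 ^ _) IHz IHx => p IHz IHx; lia.
  - have {}IHx := IHx 0 (leq0n _) (leq0n _).
    have pow_t : t + 8 <= 2 * 2 ^ t.+2.
      by elim: (t) => // t' IHt; rewrite expnS; move: (2 ^ _) IHt => r; lia.
    have le_x : e + t.+2 + 2 - 0 + 2 <= (t + 8) * (e + 1) by nia.
    have {}le_x := leq_mul (leqnn (2 ^ d')) (leq_trans le_x (leq_mul pow_t (leqnn _))).
    have {}IHx := leq_trans IHx le_x.
    by move: (2 ^ d') (2 ^ t.+2) IHx IHz => p r IHx IHz; lia.
move: bad; rewrite !negb_or -!eqn0Ngt => /and3P[/eqP e0 /eqP k0].
rewrite size_eq0 => /eqP y0; subst e k y z.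
have def_w : a :: rcons (x ++ [:: a]) b = a :: x ++ [:: a; b].
  by rewrite -cats1 -catA.
have bx : b \in x by move: bz; rewrite mem_cat mem_seq1 eq_sym (negPf ab) orbF.
rewrite def_w addn0 add0n {IHz IHx lez exp_t exp_t1 def_w}.
rewrite cats1 size_rcons nletters_rcons in lt_m def_d def_e.
have [ax|ax] := boolP (a \in x); last first.
  rewrite ax in def_d def_e.
  (* With [p = 2 ^ (d - 2)], the two bounds below give at most [(4p - 1) + (3p - 1) + 2 = 7p], less
     than the required [8p]. *)
  have le_w := npal_two_ends_notin ab ax.
  have def_d2 : d = d.-2.+2 by lia.
  have IHxb : npal (rcons x b) + 0 < 2 ^ d.-2.+1 * (0 + 2).
    by apply: IH; rewrite ?size_rcons ?nletters_rcons ?bx; lia.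
  have IHx : npal x + 0 < 2 ^ d.-2 * (1 + 2) by apply: IH; lia.
  have pow_gt0 : 0 < 2 ^ d.-2 by rewrite expn_gt0.
  rewrite {1}def_d2; move: IHxb IHx pow_gt0; rewrite !expnS.
  by move: (2 ^ _) => p; lia.
rewrite ax in def_d def_e.
have [y [x' [def_x yb]]] : exists y x' : seq T, x = y ++ b :: x' /\ b \notin y.
  exact: split_first.
have eq_x : x =i b :: (y ++ x').
  by move=> c; rewrite def_x !(inE, mem_cat) orbCA.
have ayx : a \in y ++ x' by move: ax; rewrite eq_x inE (negPf ab).
have le_w : npal (a :: x ++ [:: a; b]) <= 2 * npal x + npal (rcons (y ++ x') a).
  by rewrite -cats1 -catA {1 2}def_x; apply: npal_two_ends_in; rewrite // -def_x.
have sz_x : size x = (size (y ++ x')).+1 by rewrite def_x !size_cat addnS.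
have nl_x := eq_nletters eq_x; rewrite nletters_cons in nl_x.
have sz_yx := nletters_le x.
(* With [p = 2 ^ (d - 3)], the target is [16p = 2 * 5p + 6p]. *)
have def_d3 : d = d.-2.-1.+3 by lia.
have IHx : npal x + 0 < 2 ^ d.-2.-1 * (3 + 2) by apply: IH; lia.
have IHy : npal (rcons (y ++ x') a) + 0 < 2 ^ d.-2.-1 * 6.
  (* If [b] survives, the parameters are those of [x], giving [5p]; otherwise one letter is lost and
     the bound is [2p * 3]. *)
  case: (b \in y ++ x') nl_x => /= nl_x.
    have: npal (rcons (y ++ x') a) + 0 < 2 ^ d.-2.-1 * (3 + 2).
      by apply: IH; rewrite ?size_rcons ?nletters_rcons ?ayx; lia.
    by move: (2 ^ _) => p; lia.
  have: npal (rcons (y ++ x') a) + 0 < 2 ^ d.-2.-1.+1 * (1 + 2).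
    by apply: IH; rewrite ?size_rcons ?nletters_rcons ?ayx; lia.
  by rewrite expnS; move: (2 ^ _) => p; lia.
by rewrite {1}def_d3 !expnS; move: (2 ^ _) IHx IHy => p IHx IHy; lia.
Qed.

(** * The lower bound from nested words *)

Lemma npal_uniq_ge s : uniq s -> size s + 1 <= npal s.
Proof.
move=> us; have -> : size s + 1 = size ([::] :: [seq [:: c] | c <- s]).
  by rewrite /= size_map addn1.
apply: npal_ge => [|u].
  rewrite /= map_inj_uniq ?us ?andbT => [|c1 c2 [] //].
  by apply/mapP => -[].
rewrite inE => /predU1P[->|/mapP[c cs ->]]; first by rewrite sub0seq.
by rewrite /palindrome eqxx sub1seq.
Qed.

(** As [a] is new, the families that cover in [npal_wrap_le] are disjoint. *)
Lemma npal_wrap_ge a z : a \notin z -> 2 * npal z + 1 <= npal (wrap a z).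
Proof.
move=> az; have -> : 2 * npal z + 1 =
    size ([:: a] :: palseqs z ++ map (wrap a) (palseqs z)).
  by rewrite /= size_cat size_map -/(npal z); lia.
have az_notin u : a \in u -> u \notin palseqs z.
  move=> au; rewrite mem_palseqs andbC.
  by apply/negP => /andP[/mem_subseq/(_ a au)]; rewrite (negPf az).
apply: npal_ge => [|u].
  rewrite /= mem_cat negb_or az_notin ?mem_head //= cat_uniq undup_uniq.
  rewrite map_inj_uniq ?undup_uniq ?andbT; last exact: wrap_inj.
  apply/andP; split; first by apply/mapP => -[[|c v] _ []].
  by apply/hasPn => u /mapP[v _ ->]; rewrite az_notin ?mem_head.
rewrite inE mem_cat => /or3P[/eqP ->|uz|/mapP[v vz ->]].
- by rewrite /palindrome eqxx sub1seq mem_head.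
- move: uz; rewrite mem_palseqs => /andP[-> /subseq_trans -> //].
  by rewrite /wrap -rcons_cons (subseq_trans (subseq_cons z a)) ?subseq_rcons.
- move: vz; rewrite mem_palseqs palindrome_wrap => /andP[-> vz].
  by rewrite /wrap /= eqxx -!cats1 cat_subseq.
Qed.

Lemma npal_nested s t : uniq (s ++ t) ->
  2 ^ size s * (size t + 2) <= npal (s ++ t ++ rev s) + 1.
Proof.
elim: s => [|a s IH] /=.
  by move=> /npal_uniq_ge; rewrite cats0; lia.
rewrite mem_cat negb_or => /andP[/andP[as_ at_] /IH {}IH].
have -> : a :: s ++ t ++ rev (a :: s) = wrap a (s ++ t ++ rev s).
  by rewrite rev_cons /wrap -!rcons_cat.
have /npal_wrap_ge : a \notin s ++ t ++ rev s.
  by rewrite !mem_cat mem_rev (negPf as_) (negPf at_).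
by rewrite expnS; move: (2 ^ _) IH => p; lia.
Qed.

(** * Transfer to [SP] and [Alph], and the maximum *)

Lemma npal_SP w : npal w = (SP w).+1.
Proof.
rewrite /SP; set A := [set _ | _].
have -> : (#|A|).+1 = size ([::] :: [seq val u | u : (size w).-bseq T in A]).
  by rewrite /= size_map -cardE.
apply: perm_size; apply: uniq_perm; first exact: undup_uniq.
  rewrite /= map_inj_uniq ?enum_uniq ?andbT; last exact: val_inj.
  by apply/mapP => -[u]; rewrite mem_enum inE => /and3P[/eqP + _ _] => + E; case.
move=> u; rewrite mem_palseqs inE; have [->|u0] := eqVneq u [::].
  by rewrite sub0seq.
apply/idP/mapP => [/andP[pal_u uw]|[v + ->]]; last first.
  by rewrite mem_enum inE => /and3P[_ -> ->].
exists (Bseq (size_subseq uw)) => //.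
by rewrite mem_enum inE /= u0 pal_u.
Qed.

Lemma nletters_Alph w : #|Alph w| = nletters w.
Proof.
rewrite /nletters -(card_uniqP (undup_uniq w)).
by apply: eq_card => c; rewrite inE mem_undup.
Qed.

End PalindromicSubwords.

Theorem theorem5p4 (Sigma : finType) (n q : nat)
  (hn : 1 <= n) (hq1 : 1 <= q) (hqn : q <= n) (hSigma : q <= #|Sigma|)
  (hq : n <= 2 * q) :
  SPmax Sigma n q = 2 ^ (n - q) * (2 * q - n + 2) - 2.
Proof.
apply/eqP; rewrite eqn_leq; apply/andP; split.
  apply/bigmax_leqP => w /eqP; rewrite nletters_Alph => nl_w.
  (* No virtual letters at the start. The final [- 2] combines the strict inequality with the empty
     palindrome. *)
  have := @npal_bound _ w (n - q) 0 (2 * q - n).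
  rewrite size_tuple nl_w npal_SP => bound.
  by have := bound ltac:(lia) ltac:(lia); lia.
pose l := take q (enum Sigma).
have ul : uniq l by rewrite take_uniq ?enum_uniq.
have sz_l : size l = q by rewrite size_takel // -cardE.
(* [n <= 2 * q] makes [n - q <= q], so [s] has full length and [s ++ t ++ rev s] has length
   [q + (n - q) = n]. *)
pose s := take (n - q) l; pose t := drop (n - q) l.
have def_l : s ++ t = l by apply: cat_take_drop.
have sz_s : size s = n - q by rewrite size_takel // sz_l; lia.
have sz_t : size t = 2 * q - n by rewrite size_drop sz_l; lia.
have sz_w : size (s ++ t ++ rev s) == n.
  by rewrite !size_cat size_rev sz_s sz_t; lia.
have nl_w : nletters (s ++ t ++ rev s) = q.
  rewrite -sz_l -(undup_id ul) -/(nletters l); apply: eq_nletters => c.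
  by rewrite -def_l !mem_cat mem_rev; case: (c \in s); rewrite ?orbF.
have lower := @npal_nested _ s t; rewrite def_l npal_SP sz_s sz_t in lower.
apply: leq_trans (leq_bigmax_cond (Tuple sz_w) _); last first.
  by rewrite nletters_Alph /= nl_w.
by have := lower ul; rewrite /=; lia.
Qed.
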